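(* There exists $\alpha_0>0$ such that for every $0<\alpha<\alpha_0$ there is an integer $n_0$ with the following property. If $H$ is an $\alpha$-extremal $3$-uniform hypergraph on $n\geq n_0$ vertices, where $n$ is divisible by $3$, and $$\delta_1(H) \geq \binom{n-1}{2} - \binom{2n/3}{2}+1,$$ then $H$ contains a perfect matching.
   Context: A $3$-uniform hypergraph $H$ has vertex set $V(H)$ and edge set consisting of $3$-element subsets of $V(H)$. $\delta_1(H)$ is the minimum, over vertices $v$, of the number of edges containing $v$. A perfect matching is a set of pairwise disjoint edges covering all vertices. For $U\subseteq V(H)$, $d_3(U)$ is the number of edges of $H$ contained in $U$ divided by $\binom{|U|}{3}$. For $0<\alpha<1$, $H$ on $n$ vertices is $\alpha$-extremal if there is $B\subseteq V(H)$ with $|B|\geq(\tfrac{2}{3}-\alpha)n$ and $d_3(B)<\alpha$. *)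

(* Defs.v *)
From mathcomp Require Import all_boot all_order all_algebra.
From mathcomp Require Import reals.
Set Implicit Arguments. Unset Strict Implicit. Unset Printing Implicit Defensive.
Import Order.TTheory GRing.Theory Num.Theory.

Definition uniform3 (n : nat) (E : {set {set 'I_n}}) : Prop :=
  forall e, e \in E -> #|e| = 3.

Definition deg1 (n : nat) (E : {set {set 'I_n}}) (v : 'I_n) : nat :=
  #|[set e in E | v \in e]|.

Definition min_deg_ge (n : nat) (E : {set {set 'I_n}}) (d : nat) : Prop :=
  forall v : 'I_n, d <= deg1 E v.

Definition density3 (R : realType) (n : nat) (E : {set {set 'I_n}})
  (U : {set 'I_n}) : R :=
  (#|[set e in E | e \subset U]|%:R / ('C(#|U|, 3))%:R)%R.

Definition extremal (R : realType) (alpha : R) (n : nat)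
  (E : {set {set 'I_n}}) : Prop :=
  exists B : {set 'I_n},
    ((2%:R / 3%:R - alpha) * n%:R <= #|B|%:R)%R /\ (density3 R E B < alpha)%R.

Definition perfect_matching (n : nat) (E : {set {set 'I_n}})
  (M : {set {set 'I_n}}) : Prop :=
  M \subset E /\ trivIset M /\ cover M = [set: 'I_n].

(* Main.v *)
Require Import Defs.
From mathcomp Require Import all_boot all_order all_algebra all_fingroup.
From mathcomp Require Import reals zify ring.
Set Implicit Arguments. Unset Strict Implicit. Unset Printing Implicit Defensive.
Import Order.TTheory GRing.Theory Num.Theory.

(** Write [n = 3m]. Since a smaller [alpha] gives a stronger hypothesis, one fixed
    tiny [alpha] suffices, and the sparse set can be resized to a set [B0] of
    exactly [2m] vertices. The degree condition then forces almost every triple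
    meeting both [B0] and its complement to be an edge. Let [B] be the set of
    vertices [v] lying with few pairs of [B0] in an edge, and [A] its complement;
    [B] differs little from [B0], and every vertex of [B] forms an edge with
    almost every pair meeting [A].

    If [#|B| = 2m + q] with [q > 0], every vertex of [B] has at least about
    [2m(q - 1) + 1] edges inside [B] while no vertex of [B] has many, so [B] spans
    [q] disjoint edges; if [#|A| = m + p], there are [p] disjoint edges with two
    vertices in [A]. Removing them makes the two sides balanced [1 : 2]. The few
    vertices of [A] missing a non-negligible part of the pairs of [B] are then
    covered greedily, and on the rest any partition into triples of type [ABB]
    that maximises the number of edges is a perfect matching: a non-edge could be
    repaired by recombining it with two other triples. All degrees are counted
    over ordered pairs. *)

(** * Counting related pairs between finite sets *)

Definition cnt (S T : finType) (P : S -> T -> bool) (X : {set S}) (Y : {set T}) :=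
  \sum_(x in X) \sum_(y in Y) P x y.

Section Counting.
Variables S T : finType.
Implicit Types (P Q : S -> T -> bool) (X : {set S}) (Y : {set T}).

Lemma cnt_pred_le P Q X Y :
    (forall x y, x \in X -> y \in Y -> P x y -> Q x y) ->
  cnt P X Y <= cnt Q X Y.
Proof.
move=> PQ; apply: leq_sum => x xX; apply: leq_sum => y yY.
by case: (boolP (P x y)) => // /(PQ _ _ xX yY) ->.
Qed.

Lemma cnt_swap P X Y : cnt P X Y = cnt (fun y x => P x y) Y X.
Proof. exact: exchange_big. Qed.

Lemma cnt_compl P X Y : cnt P X Y + cnt (fun x y => ~~ P x y) X Y = #|X| * #|Y|.
Proof.
rewrite -big_split -sum_nat_const; apply: eq_bigr => x _ /=.
by rewrite -big_split -sum1_card; apply: eq_bigr => y _; case: (P x y).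
Qed.

Lemma cnt_max P X Y : cnt P X Y <= #|X| * #|Y|.
Proof. by rewrite -(cnt_compl P) leq_addr. Qed.

Lemma cntIDl P X Z Y : cnt P X Y = cnt P (X :&: Z) Y + cnt P (X :\: Z) Y.
Proof. exact: big_setID. Qed.

Lemma cnt_subl P X X' Y : X \subset X' -> cnt P X Y <= cnt P X' Y.
Proof. by move=> sX; rewrite (cntIDl P X' X) (setIidPr sX) leq_addr. Qed.

Lemma cntUl P X X' Y : cnt P (X :|: X') Y <= cnt P X Y + cnt P X' Y.
Proof.
rewrite (cntIDl P _ X) setUK leq_add2l; apply: cnt_subl.
by rewrite subDset subxx.
Qed.

Lemma cnt_or P Q X Y a b : cnt P X Y <= a -> cnt Q X Y <= b ->
  cnt (fun x y => P x y || Q x y) X Y <= a + b.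
Proof.
move=> Pa Qb; apply: leq_trans (leq_add Pa Qb); rewrite -big_split.
apply: leq_sum => x _ /=; rewrite -big_split.
by apply: leq_sum => y _ /=; case: (P x y); case: (Q x y).
Qed.

Lemma cnt_gt0 P X Y :
  0 < cnt P X Y -> exists x y, [/\ x \in X, y \in Y & P x y].
Proof.
rewrite lt0n sum_nat_eq0 => /forallPn [x]; rewrite negb_imply => /andP [xX].
rewrite sum_nat_eq0 => /forallPn [y]; rewrite negb_imply => /andP [yY].
by rewrite eqb0 negbK => Pxy; exists x, y.
Qed.

End Counting.

Section MoreCounting.
Variables S T : finType.
Implicit Types (P Q : S -> T -> bool) (X : {set S}) (Y : {set T}).

Lemma cntIDr P X Y Z : cnt P X Y = cnt P X (Y :&: Z) + cnt P X (Y :\: Z).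
Proof. by rewrite !(cnt_swap P) (cntIDl _ _ Z). Qed.

Lemma cnt_subr P X Y Y' : Y \subset Y' -> cnt P X Y <= cnt P X Y'.
Proof. by rewrite !(cnt_swap P); apply: cnt_subl. Qed.

Lemma cnt_sub P X X' Y Y' :
  X \subset X' -> Y \subset Y' -> cnt P X Y <= cnt P X' Y'.
Proof. by move=> sX sY; apply: leq_trans (cnt_subl _ _ sX) (cnt_subr _ _ sY). Qed.

Lemma cntUr P X Y Y' : cnt P X (Y :|: Y') <= cnt P X Y + cnt P X Y'.
Proof. by rewrite !(cnt_swap P); apply: cntUl. Qed.

(** A pair not counted in [X'] and [Y'] has its first entry in [C] or its second in [D]. This
    transfers counts between sets that differ little. *)
Lemma cnt_cover P X X' Y Y' C D :
    X \subset X' :|: C -> Y \subset Y' :|: D ->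
  cnt P X Y <= cnt P X' Y' + #|C| * #|Y| + #|X| * #|D|.
Proof.
move=> sX sY.
have sXC : X \subset (X' :&: X) :|: C.
  apply/subsetP => x xX; move/subsetP/(_ _ xX): sX.
  by rewrite !inE xX andbT.
apply: leq_trans (cnt_subl _ _ sXC) _; apply: leq_trans (cntUl _ _ _ _) _.
have := cnt_max P C Y; have := cnt_subr P (X' :&: X) sY.
have := cntUr P (X' :&: X) Y' D; have := cnt_subl P Y' (subsetIl X' X).
have := cnt_max P (X' :&: X) D.
have := leq_mul (subset_leq_card (subsetIr X' X)) (leqnn #|D|).
lia.
Qed.

Lemma cnt_reindex (I J : finType) (f : I -> S) (g : J -> T) P X Y :
    injective f -> injective g ->
    (forall i, f i \in X) -> (forall j, g j \in Y) ->
  cnt (fun i j => P (f i) (g j)) setT setT <= cnt P X Y.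
Proof.
move=> fI gI fX gY.
have sf : f @: setT \subset X by apply/subsetP => _ /imsetP [i _ ->].
have sg : g @: setT \subset Y by apply/subsetP => _ /imsetP [i _ ->].
apply: leq_trans (cnt_sub P sf sg).
rewrite /cnt big_imset /=; last by move=> ? ? _ _; apply: fI.
by apply: leq_sum => i _; rewrite big_imset //= => ? ? _ _; apply: gI.
Qed.

End MoreCounting.

Lemma card_mul_le_sum (T : finType) (X : {set T}) (f : T -> nat) k :
  (forall x, x \in X -> k <= f x) -> #|X| * k <= \sum_(x in X) f x.
Proof. by move=> kf; rewrite -sum_nat_const; apply: leq_sum. Qed.

Lemma sum_le_card_mul (T : finType) (X : {set T}) (f : T -> nat) k :
  (forall x, x \in X -> f x <= k) -> \sum_(x in X) f x <= #|X| * k.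
Proof. by move=> kf; rewrite -sum_nat_const; apply: leq_sum. Qed.

(** * Pairing indices by local exchange *)

Lemma tpermE (T : finType) (x y z : T) :
  tperm x y z = if z == x then y else if z == y then x else z.
Proof.
case: tpermP => [->|->|/eqP/negPf -> /eqP/negPf -> //]; rewrite eqxx //.
by case: eqP.
Qed.

(* If position [i0] fails, almost all [i1, i2] allow the three triples at
   [i0, i1, i2] to be made good at once by exchanging their bool-indexed parts. *)
Lemma pairing_perm (I : finType) (P : I -> I * bool -> I * bool -> bool) D :
    (forall i, cnt (fun j k => ~~ P i j k) setT setT <= D) ->
    (forall j, cnt (fun i k => ~~ P i j k) setT setT <= D) ->
    3 * D + 3 * #|I| < #|I| * #|I| ->
  exists s : {perm I * bool}, forall i, P i (s (i, true)) (s (i, false)).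
Proof.
move=> degI degJ big.
pose good (s : {perm I * bool}) := [set i | P i (s (i, true)) (s (i, false))].
case: (@arg_maxnP _ (1%g : {perm I * bool}) xpredT (fun s => #|good s|)) => // s _ smax.
exists s => i0; apply/negPn/negP => bad0.
pose injb (b : bool) : injective (fun i : I => s (i, b)) :=
  fun i j e => congr1 fst (perm_inj e).
(* The first three alternatives say that one of the exchanged triples is bad, at most [D] pairs
   each; the last three are coincidences of positions, at most [#|I|] pairs each. *)
pose Q (i1 i2 : I) := ~~ P i0 (s (i1, true)) (s (i2, true))
  || (~~ P i1 (s (i0, true)) (s (i2, false))
  || (~~ P i2 (s (i0, false)) (s (i1, false))
  || ((i1 == i0) || ((i2 == i0) || (i1 == i2))))).
have Qle : cnt Q setT setT <= 3 * D + 3 * #|I|.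
  have cQ1 := leq_trans (cnt_reindex (fun j k => ~~ P i0 j k) (injb true) (injb true)
    (fun=> in_setT _) (fun=> in_setT _)) (degI i0).
  have cQ2 := leq_trans (cnt_reindex (fun i k => ~~ P i (s (i0, true)) k) (@inj_id I) (injb false)
    (fun=> in_setT _) (fun=> in_setT _)) (degJ (s (i0, true))).
  have cQ3 := leq_trans (cnt_reindex (fun i k => ~~ P i (s (i0, false)) k) (@inj_id I) (injb false)
    (fun=> in_setT _) (fun=> in_setT _)) (degJ (s (i0, false))).
  have one (i : I) : \sum_(j in [set: I]) (j == i) = 1.
    by rewrite (bigD1 i) ?inE //= eqxx big1 // => j /andP [_ /negPf ->].
  have cQ4 : cnt (fun i1 i2 : I => i1 == i0) setT setT <= #|I|.
    rewrite /cnt exchange_big /= (eq_bigr (fun=> 1)) => [|i _]; last exact: one.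
    by rewrite sum_nat_const muln1 cardsT.
  have cQ5 : cnt (fun i1 i2 : I => i2 == i0) setT setT <= #|I|.
    rewrite /cnt (eq_bigr (fun=> 1)) => [|i _]; last exact: one.
    by rewrite sum_nat_const muln1 cardsT.
  have cQ6 : cnt (fun i1 i2 : I => i1 == i2) setT setT <= #|I|.
    rewrite /cnt exchange_big /= (eq_bigr (fun=> 1)) => [|i _]; last exact: one.
    by rewrite sum_nat_const muln1 cardsT.
  rewrite cnt_swap in cQ3.
  apply: leq_trans (cnt_or cQ1 (cnt_or cQ2 (cnt_or cQ3 (cnt_or cQ4 (cnt_or cQ5 cQ6))))) _.
  lia.
have : 0 < cnt (fun i j => ~~ Q i j) setT setT.
  have := cnt_compl Q setT setT; rewrite !cardsT; lia.
case/cnt_gt0 => i1 [i2 [_ _]]; rewrite !negb_or !negbK.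
case/and5P => P0 P1 P2 n10 /andP [n20 n12].
(* As [i0], [i1], [i2] are distinct, these swaps are disjoint and produce exactly the three triples
   tested in [Q]. Other positions keep theirs, so [i0] is a net gain, against the maximality of
   [s]. *)
pose t : {perm I * bool} := (tperm (i0, true) (i1, true) *
  (tperm (i0, false) (i2, true) * tperm (i1, false) (i2, false)) * s)%g.
have := smax t isT; rewrite /geq /= leqNgt => /negP; apply; apply: proper_card; apply/properP.
have [n01 n02 n21] : [/\ i0 != i1, i0 != i2 & i2 != i1] by rewrite !(eq_sym _ i1) !(eq_sym i0).
have tE := (permM, tpermE, xpair_eqE, eqxx, negPf n10, negPf n20, negPf n12,
  negPf n01, negPf n02, negPf n21, andbF).
have t0 : i0 \in good t by rewrite inE; do !rewrite !tE /=.
split; last by exists i0 => //; rewrite inE.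
apply/subsetP => i; rewrite !inE => Pi.
have [->|ni0] := eqVneq i i0; first by rewrite inE in t0.
have [->|ni1] := eqVneq i i1; first by do !rewrite !tE /=.
have [->|ni2] := eqVneq i i2; first by do !rewrite !tE /=.
by do !rewrite !tE ?(negPf ni0) ?(negPf ni1) ?(negPf ni2) /=.
Qed.

(** * Partial matchings of a hypergraph *)

Section Hypergraph.
Variables (T : finType) (E : {set {set T}}).
Implicit Types (A B S X Y Z : {set T}) (x y z : T).

(** The arguments may coincide; 3-uniformity makes such a triple a non-edge, so [nadj] also counts
    degenerate triples. *)
Definition adj x y z := [set x; y; z] \in E.
Definition nadj x y z := ~~ adj x y z.

Definition matchable X :=
  exists M : {set {set T}}, [/\ M \subset E, trivIset M & cover M = X].

Lemma adjCA x y z : adj x y z = adj y x z.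
Proof. by rewrite /adj (setUC [set x]). Qed.

Lemma adjAC x y z : adj x y z = adj x z y.
Proof. by rewrite /adj setUAC. Qed.

Lemma matchable0 : matchable set0.
Proof.
exists set0; split; rewrite ?sub0set ?/cover ?big_set0 //.
by apply/trivIsetP => A B; rewrite inE.
Qed.

Lemma matchable_edge e : e \in E -> matchable e.
Proof.
move=> eE; exists [set e]; split; first by rewrite sub1set.
  by apply/trivIsetP => A B /set1P -> /set1P ->; rewrite eqxx.
by rewrite /cover big_set1.
Qed.

Lemma matchableU X Y :
  matchable X -> matchable Y -> [disjoint X & Y] -> matchable (X :|: Y).
Proof.
move=> [M [ME tM cM]] [N [NE tN cN]] dXY; exists (M :|: N).
by split; rewrite ?subUset ?ME ?trivIsetU ?cM ?cN // /cover bigcup_setU -cM -cN.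
Qed.

Hypothesis E3 : forall e, e \in E -> #|e| = 3.

Lemma adj_neq x y z : adj x y z -> [/\ x != y, x != z & y != z].
Proof.
move=> /E3; rewrite -setUA cardsU1 cards2 !inE negb_or.
by case: (x != y); case: (x != z); case: (y != z).
Qed.

(** Fewer than [k] edges occupy at most [3 * k - 3] vertices, so the hypothesis always supplies one
    more. Balancing uses [r = 0] and [r = 2]. *)
Lemma greedy_matching A r k :
    (forall S, #|S| + 3 <= 3 * k ->
      exists e, [/\ e \in E, [disjoint e & S] & #|e :&: A| = r]) ->
  exists X, [/\ matchable X, #|X| = 3 * k & #|X :&: A| = r * k].
Proof.
elim: k => [_|k IHk grow].
  by exists set0; rewrite set0I cards0 !muln0; split=> //; apply: matchable0.
have [|X [mX cX cXA]] := IHk; first by move=> S leS; apply: grow; lia.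
have [|e [eE deX ceA]] := grow X; first by lia.
exists (e :|: X); split; first exact: matchableU (matchable_edge eE) mX deX.
  by rewrite cardsU disjoint_setI0 // cards0 E3 // cX; lia.
rewrite setIUl cardsU ceA cXA setIACA (disjoint_setI0 deX) set0I cards0; lia.
Qed.

(** One edge is chosen per vertex of [Z]; [X0] and the earlier edges block at most
    [#|X0| + 3 * #|Z|] vertices. Avoiding [X0] lets the result be joined to a matching already
    chosen there. *)
Lemma greedy_cover Z B X0 :
    [disjoint Z & B] -> [disjoint Z & X0] ->
    (forall z S, z \in Z -> #|S| <= #|X0| + 3 * #|Z| ->
      exists y w, [/\ y \in B :\: S, w \in B :\: S & adj z y w]) ->
  exists X, [/\ matchable X, Z \subset X, X \subset Z :|: B,
                [disjoint X & X0] & #|X| = 3 * #|Z|].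
Proof.
move cZ : #|Z| => k; elim: k Z cZ => [|k IHk] Z cZ dZB dZX grow.
  exists set0; move/eqP: cZ; rewrite cards_eq0 => /eqP ->.
  rewrite !sub0set cards0 muln0 -setI_eq0 set0I eqxx; split=> //; exact: matchable0.
have /card_gt0P [z zZ] : 0 < #|Z| by rewrite cZ.
have cZz : #|Z :\ z| = k by have := cardsD1 z Z; rewrite zZ cZ; lia.
have dZz Y : [disjoint Z & Y] -> [disjoint Z :\ z & Y].
  by apply: disjointWl; rewrite subD1set.
have [||y S /setD1P [_ yZ] leS|X [mX ZX XZB dX cX]] := IHk (Z :\ z) cZz.
- exact: dZz.
- exact: dZz.
- by apply: grow => //; lia.
have [|y [w [yB wB zyw]]] := grow z (X0 :|: X) zZ.
  by have := leq_card_setU X0 X; move/leqifP; case: ifP => _; lia.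
move: yB wB; rewrite !inE !negb_or -!andbA => /and3P [yX0 yX yB] /and3P [wX0 wX wB].
have zB : z \notin B by apply: contraTN zZ => zB; rewrite (disjointFl dZB).
have zX : z \notin X.
  by apply/negP => /(subsetP XZB); rewrite !inE eqxx (negPf zB).
have zX0 : z \notin X0 by rewrite (disjointFr dZX).
have de Y : z \notin Y -> y \notin Y -> w \notin Y -> [disjoint [set z; y; w] & Y].
  by rewrite disjoints_subset !subUset !sub1set !inE => -> -> ->.
exists ([set z; y; w] :|: X); split.
- exact: matchableU (matchable_edge zyw) mX (de _ zX yX wX).
- apply/subsetP => x xZ; rewrite !inE.
  have [//|xz] := eqVneq x z; have : x \in Z :\ z by rewrite !inE xz.
  by move/(subsetP ZX) ->; rewrite orbT.
- apply/subsetP => x; rewrite !inE -!orbA => /or4P [/eqP ->|/eqP ->|/eqP ->|].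
  + by rewrite zZ.
  + by rewrite yB orbT.
  + by rewrite wB orbT.
  + by move/(subsetP XZB); rewrite !inE => /orP [/andP [_ ->]|->]; rewrite ?orbT.
- rewrite -setI_eq0 setIUl setU_eq0 !setI_eq0 dX andbT; exact: de.
- by rewrite cardsU (disjoint_setI0 (de _ zX yX wX)) cards0 (E3 zyw) cX subn0 mulnS.
Qed.

(** Numbering [A] by [I] and [B] by [I * bool] hands each vertex of [A] two partners; [pairing_perm]
    reorders [B] so that all these triples are edges. *)
Lemma matchable_dense A B D :
    #|B| = 2 * #|A| -> [disjoint A & B] ->
    (forall a, a \in A -> cnt (nadj a) B B <= D) ->
    (forall b, b \in B -> cnt (nadj b) A B <= D) ->
    3 * D + 3 * #|A| < #|A| * #|A| ->
  matchable (A :|: B).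
Proof.
move=> cB dAB degA degB big.
pose I : finType := 'I_#|A|; pose a (i : I) : T := enum_val i.
have cJ : #|{: I * bool}| = #|B| by rewrite card_prod card_ord card_bool cB mulnC.
pose g (j : I * bool) : T := enum_val (cast_ord cJ (enum_rank j)).
have aA i : a i \in A by apply: enum_valP.
have gB j : g j \in B by apply: enum_valP.
have aI : injective a by apply: enum_val_inj.
have gI : injective g by move=> j k /enum_val_inj/cast_ord_inj/enum_rank_inj.
have aS x : x \in A -> exists i, x = a i.
  by move=> xA; exists (enum_rank_in xA x); rewrite /a enum_rankK_in.
have gS x : x \in B -> exists j, x = g j.
  move=> xB; exists (enum_val (cast_ord (esym cJ) (enum_rank_in xB x))).
  by rewrite /g enum_valK cast_ordKV enum_rankK_in.
have [i|j||s sP] := @pairing_perm I (fun i j k => adj (a i) (g j) (g k)) D.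
- exact: leq_trans (cnt_reindex (nadj (a i)) gI gI gB gB) (degA _ (aA i)).
- apply: leq_trans (degB _ (gB j)).
  apply: leq_trans (cnt_reindex (nadj (g j)) aI gI aA gB).
  by apply: cnt_pred_le => i k _ _; rewrite /nadj adjCA.
- by rewrite card_ord.
pose F (i : I) := [set a i; g (s (i, true)); g (s (i, false))].
have FA i x : x \in F i -> x \in A -> x = a i.
  rewrite !inE -orbA => /or3P [/eqP -> //|/eqP ->|/eqP ->] gA;
  by have := disjointFr dAB gA; rewrite gB.
have FB i x : x \in F i -> x \in B -> exists b, x = g (s (i, b)).
  rewrite !inE -orbA => /or3P [/eqP ->|/eqP ->|/eqP ->] xB;
    [|by exists true|by exists false].
  by have := disjointFl dAB xB; rewrite aA.
have FAB i x : x \in F i -> (x \in A) || (x \in B).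
  by rewrite !inE -orbA => /or3P [/eqP ->|/eqP ->|/eqP ->]; rewrite ?aA ?gB ?orbT.
have [||tF _] := @trivIimset T I xpredT F.
- move=> i j _ _ nij; rewrite -setI_eq0; apply/set0Pn => -[x /setIP [xi xj]].
  case/orP: (FAB _ _ xi) => [xA|xB].
    move: nij; rewrite -(inj_eq aI) -(FA _ _ xi xA) -(FA _ _ xj xA).
    by rewrite eqxx.
  have [b xb] := FB _ _ xi xB; have [c] := FB _ _ xj xB; rewrite xb => /gI/perm_inj [eij].
  by rewrite eij eqxx in nij.
- by apply/imsetP => -[i _ /setP /(_ (a i))]; rewrite !inE eqxx.
exists [set F i | i : I]; split=> //.
  by apply/subsetP => _ /imsetP [i _ ->]; apply: sP.
rewrite cover_imset; apply/setP => x; rewrite inE; apply/bigcupP/orP.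
  by move=> [i _ /FAB/orP].
case=> [/aS [i ->]|/gS [j ->]]; first by exists i => //; rewrite !inE eqxx.
have [[i b] ->] : exists k, j = s k by exists (s^-1 j)%g; rewrite permKV.
by exists i => //; rewrite !inE; case: b; rewrite eqxx ?orbT.
Qed.

End Hypergraph.

(** * Structure around the sparse set [B0] *)

Section Extremal.
Variables (T : finType) (E : {set {set T}}) (m : nat) (B0 : {set T}).
Hypothesis E3 : forall e, e \in E -> #|e| = 3.
Hypothesis cT : #|T| = 3 * m.
Hypothesis m_large : 100 * 100 * 100 <= m.
(* Over ordered pairs, so that 2 ((3m-1 choose 2) - (2m choose 2) + 1)
   is [5m^2 - 7m + 4]. *)
Hypothesis deg : forall v, 5 * (m * m) + 4 <= cnt (adj E v) setT setT + 7 * m.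
Hypothesis cB0 : #|B0| = 2 * m.
Let e3 := \sum_(x in B0) cnt (adj E x) B0 B0.
Hypothesis sparse : 100 * 100 * e3 <= m * (m * m).

Local Notation adj := (adj E).
Local Notation nadj := (nadj E).
Implicit Types (v a b : T) (S X : {set T}).

Let A0 := ~: B0.
Let c v := cnt (adj v) B0 B0.
(** The cutoff here and in [Z0] is one fortieth of the [4 * (m * m)] ordered pairs of [B0]. *)
Let B := [set v | 10 * c v <= m * m].
Let A := ~: B.
Let Z0 := [set a in A | m * m < 10 * cnt (nadj a) B0 B0].

Let nadj_B0 v : c v + cnt (nadj v) B0 B0 = 4 * (m * m).
Proof. by rewrite /c cnt_compl cB0; lia. Qed.

(** By [deg], [v] misses at most [4 * (m * m) + 7 * m] ordered pairs in all, and [4 * (m * m) - c v]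
    of the missed ones lie inside [B0]. *)
Let nadj_A0 v : cnt (nadj v) A0 setT <= 7 * m + c v.
Proof.
have := cnt_compl (adj v) setT setT; rewrite cardsT cT -/(nadj v).
have := deg v; have := nadj_B0 v.
have := cntIDl (nadj v) setT B0 setT; rewrite setTI setTD -/A0.
have := cnt_subr (nadj v) B0 (subsetT B0).
by lia.
Qed.

(** Double counting: a missing triple with a vertex in [X] and two in [B0] is charged to a vertex
    [b] of [B0], where [nadj_A0] applies; the [c b] add up to [e3]. *)
Let sum_nadj_A0 X : X \subset A0 ->
  \sum_(a in X) cnt (nadj a) B0 B0 <= 14 * (m * m) + e3.
Proof.
move=> XA.
apply: (@leq_trans (\sum_(b in B0) cnt (nadj b) A0 setT)).
  rewrite /cnt exchange_big /=; apply: leq_sum => b _.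
  apply: leq_trans (cnt_sub (nadj b) XA (subsetT B0)).
  apply: leq_sum => a _; apply: leq_sum => y _.
  by rewrite /nadj adjCA.
apply: (@leq_trans (\sum_(b in B0) (7 * m + c b))); first exact: leq_sum.
by rewrite big_split /= sum_nat_const cB0 leq_add //; lia.
Qed.

Let mm_gt0 : 0 < m * m.
Proof. by rewrite muln_gt0; apply/andP; split; lia. Qed.

Let m_small : 100 * 100 * 100 * (m * m) <= m * (m * m).
Proof. by rewrite leq_mul2r m_large orbT. Qed.

Let mm_large : 100 * 100 * 100 * m <= m * m.
Proof. by rewrite leq_mul2r m_large orbT. Qed.

(** A vertex of [A0] in [B] misses at least [3 * (m * m)] pairs of [B0], which [sum_nadj_A0] permits
    only rarely. The next two bounds are averaging arguments of the same kind. *)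
Let card_BA0 : 100 * 100 * #|A0 :&: B| <= m.
Proof.
have := sum_nadj_A0 (subsetIl A0 B).
have : #|A0 :&: B| * (3 * (m * m)) <= \sum_(a in A0 :&: B) cnt (nadj a) B0 B0.
  apply: card_mul_le_sum => a; rewrite !inE => /andP [_ ca].
  by have := nadj_B0 a; lia.
move=> le1 le2; rewrite -(leq_pmul2r mm_gt0); lia.
Qed.

Let card_AB0 : 1000 * #|B0 :&: A| <= m.
Proof.
have : \sum_(a in B0 :&: A) c a <= e3.
  by rewrite /e3 [leqRHS](big_setID A) /= leq_addr.
have : #|B0 :&: A| * (m * m) <= \sum_(a in B0 :&: A) 10 * c a.
  apply: card_mul_le_sum => a; rewrite !inE => /andP [_ ca]; lia.
rewrite -big_distrr /= => le1 le2; rewrite -(leq_pmul2r mm_gt0); lia.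
Qed.

Let card_Z0 : 400 * #|Z0| <= m.
Proof.
have : 800 * #|A0 :&: Z0| <= m.
  have := sum_nadj_A0 (subsetIl A0 Z0).
  have : #|A0 :&: Z0| * (m * m) <= \sum_(a in A0 :&: Z0) 10 * cnt (nadj a) B0 B0.
    apply: card_mul_le_sum => a; rewrite !inE => /and3P [_ _ ca]; lia.
  rewrite -big_distrr /= => le1 le2; rewrite -(leq_pmul2r mm_gt0); lia.
have : #|Z0 :&: B0| <= #|B0 :&: A|.
  apply/subset_leq_card/subsetP => x; rewrite !inE => /andP [/andP [-> _] ->] //.
have := cardsID B0 Z0; rewrite setDE (setIC Z0 (~: B0)) -/A0.
by have := card_AB0; lia.
Qed.

Let card_AB : #|A| + #|B| = 3 * m.
Proof. by rewrite addnC cardsC cT. Qed.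

Let card_B : #|B| + #|B0 :&: A| = 2 * m + #|A0 :&: B|.
Proof.
have := cardsID B0 B; have := cardsID B B0; rewrite cB0 !setDE -/A -/A0.
by rewrite (setIC B0 B) (setIC B A0); lia.
Qed.

(** The slack between 1/10 and 1/8 absorbs the passage from [B0] to [B], here and in [nadj_BB] and
    [adj_BB]. *)
Let nadj_A b : b \in B -> 8 * cnt (nadj b) A setT <= m * m.
Proof.
rewrite inE => cb; have := nadj_A0 b.
have sA : A \subset A0 :|: (B0 :&: A).
  by apply/subsetP => x xA; rewrite in_setU in_setI xA andbT inE orNb.
have := cnt_cover (nadj b) sA (subsetUl setT set0); rewrite cards0 cardsT cT.
move=> le1 le2.
have : #|B0 :&: A| * (1000 * m) <= m * m by have := leq_mul card_AB0 (leqnn m); lia.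
have := mm_large; lia.
Qed.

Let subBB0 : B \subset B0 :|: (A0 :&: B).
Proof. by apply/subsetP => x xB; rewrite in_setU in_setI xB andbT inE orbN. Qed.

Let cnt_BB P : cnt P B B <= cnt P B0 B0 + 2 * (#|A0 :&: B| * (3 * m)).
Proof.
have := cnt_cover P subBB0 subBB0.
have : #|B| <= 3 * m by lia.
move=> /(leq_mul (leqnn #|A0 :&: B|)); lia.
Qed.

Let card_BA0_mul : 100 * 100 * (#|A0 :&: B| * m) <= m * m.
Proof. by have := leq_mul card_BA0 (leqnn m); lia. Qed.

Let nadj_BB a : a \in A :\: Z0 -> 8 * cnt (nadj a) B B <= m * m.
Proof.
rewrite !inE negb_and -leqNgt => /andP [/orP [/negPf -> //|ca] _].
have := cnt_BB (nadj a); have := card_BA0_mul; lia.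
Qed.

Let adj_BB b : b \in B -> 8 * cnt (adj b) B B <= m * m.
Proof.
rewrite inE => cb; have := cnt_BB (adj b); rewrite -/(c b).
have := card_BA0_mul; lia.
Qed.

(** The term [3 * #|A|] comes from degenerate pairs: for [y] in [A], none of [(b, y)], [(y, b)],
    [(y, y)] forms an edge with [b]. Without it the bound would be void when [#|B| = 2 * m + 1]. *)
Let adj_BB_lower b : b \in B ->
  #|B| * #|B| + 3 * #|A| + 4 <= cnt (adj b) B B + 4 * (m * m) + 7 * m.
Proof.
move=> bB; have := deg b.
have := cnt_compl (adj b) setT setT; rewrite cardsT cT -/(nadj b).
have := cnt_compl (adj b) B B; rewrite -/(nadj b).
have := cntIDl (nadj b) setT B setT; rewrite setTI setTD -/A.
have := cntIDr (nadj b) B setT B; rewrite setTI setTD -/A.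
have degenerate x y z : [|| x == y, x == z | y == z] -> nadj x y z.
  by move=> xyz; apply/negP => /(adj_neq E3); case/or3P: xyz => /eqP ->; rewrite eqxx; case.
have : #|A| <= cnt (nadj b) B A.
  rewrite /cnt (bigD1 b) //= -sum1_card; apply: leq_trans (leq_addr _ _).
  by apply: leq_sum => z _; rewrite degenerate ?eqxx.
have : #|A| * 2 <= cnt (nadj b) A setT.
  apply: card_mul_le_sum => y yA.
  have nyb : y != b by apply: contraTneq yA => ->; rewrite inE bB.
  rewrite (bigD1 b) ?inE //= (bigD1 y) ?inE //= !degenerate ?eqxx ?orbT //.
lia.
Qed.

(** * Balancing the two sides *)

Let edges_in_B q : #|B| = 2 * m + q.+1 ->
  exists X, [/\ matchable E X, #|X| = 3 * q.+1 & #|X :&: A| = 0 * q.+1].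
Proof.
move=> cB; apply: greedy_matching => // S cS.
(* The exact value is [4mq + q^2 - q + 2]. The 2 stands for a single edge; it is all that is left
   when [q = 0], and is owed to the [+ 1] in the degree condition. *)
have lowB b : b \in B -> 4 * (m * q) + 2 <= cnt (adj b) B B.
  move=> bB; have := adj_BB_lower bB; have := card_AB; rewrite cB => cA.
  have -> : #|A| = m - q.+1 by lia.
  nia.
pose D := B :\: S; pose S' := B :&: S.
have split b : cnt (adj b) B B <= cnt (adj b) D D + 2 * cnt (adj b) S' B.
  have := cntIDl (adj b) B S B; have := cntIDr (adj b) (B :\: S) B S.
  have := cnt_subl (adj b) (B :&: S) (subsetDl B S).
  have -> : cnt (adj b) B (B :&: S) = cnt (adj b) S' B.
    by rewrite cnt_swap; apply: eq_bigr => x _; apply: eq_bigr => y _; rewrite adjAC.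
  rewrite -/D -/S'; lia.
have cS' : #|S'| <= 3 * q by have := subset_leq_card (subsetIr B S); rewrite -/S'; lia.
have cD : m <= #|D|.
  have := cardsID S B; rewrite -/S' -/D cB; have := card_BA0; have := card_B; lia.
(* Triples meeting [S'] are charged to their vertex there; [adj_BB] caps each charge, and there are
   at most [3 * q] such vertices. Even doubled, the loss stays below [m * (4 * (m * q) + 2)], also
   for [q = 0]. *)
have loss : 8 * \sum_(b in D) cnt (adj b) S' B <= 3 * q * (m * m).
  apply: (@leq_trans (8 * \sum_(s in S') cnt (adj s) B B)).
    rewrite leq_mul2l /= /cnt [leqLHS]exchange_big /=; apply: leq_sum => s _.
    apply: leq_trans (cnt_subl _ _ (subsetDl B S)).
    by apply: leq_sum => b _; apply: leq_sum => y _; rewrite adjCA.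
  rewrite big_distrr /=.
  apply: (@leq_trans (#|S'| * (m * m))); last by rewrite leq_mul2r cS' orbT.
  by apply: sum_le_card_mul => s /setIP [sB _]; apply: adj_BB.
have : 0 < \sum_(b in D) cnt (adj b) D D.
  have : #|D| * (4 * (m * q) + 2) <=
      \sum_(b in D) (cnt (adj b) D D + 2 * cnt (adj b) S' B).
    apply: card_mul_le_sum => b /setDP [bB _].
    exact: leq_trans (lowB _ bB) (split b).
  rewrite big_split -big_distrr /=.
  have := leq_mul cD (leqnn (4 * (m * q) + 2)).
  have : 0 < m by lia.
  lia.
rewrite lt0n sum_nat_eq0 => /forallPn [x]; rewrite negb_imply -lt0n => /andP [xD].
case/cnt_gt0 => y [z [yD zD xyz]]; exists [set x; y; z]; split=> //.
  rewrite disjoints_subset !subUset !sub1set.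
  by move: xD yD zD; rewrite !inE => /andP [-> _] /andP [-> _] /andP [-> _].
apply/eqP; rewrite cards_eq0 setI_eq0 disjoints_subset setCK !subUset !sub1set.
by move: xD yD zD; rewrite !(in_setD B S) => /andP [_ ->] /andP [_ ->] /andP [_ ->].
Qed.

(** A fresh [b] in [B] misses at most [m * m / 8] pairs meeting [A] in their first entry, while
    [A :\: S] still has at least [m * m / 4] ordered pairs. *)
Let edges_AAB p : #|A| = m + p ->
  exists X, [/\ matchable E X, #|X| = 3 * p & #|X :&: A| = 2 * p].
Proof.
move=> cA; apply: greedy_matching => // S cS.
have pm : 1000 * p <= m by have := card_AB0; have := card_B; have := card_AB; lia.
have /card_gt0P [b] : 0 < #|B :\: S|.
  by have := cardsID S B; have := subset_leq_card (subsetIr B S); have := card_AB; lia.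
case/setDP => bB bS.
have : 0 < cnt (adj b) (A :\: S) (A :\: S).
  have := cnt_compl (adj b) (A :\: S) (A :\: S); rewrite -/(nadj b).
  have := cnt_sub (nadj b) (subsetDl A S) (subsetT (A :\: S)).
  have := nadj_A bB.
  have cD : m <= 2 * #|A :\: S|.
    by have := cardsID S A; have := subset_leq_card (subsetIr A S); lia.
  have := leq_mul cD cD; lia.
case/cnt_gt0 => y [z [/setDP [yA yS] /setDP [zA zS] byz]].
exists [set b; y; z]; split=> //.
  by rewrite disjoints_subset !subUset !sub1set !inE bS yS zS.
have [_ _ nyz] := adj_neq E3 byz.
suff -> : [set b; y; z] :&: A = [set y; z] by rewrite cards2 nyz.
apply/setP => x; rewrite in_setI !in_setU !in_set1.
have [->|_] := eqVneq x y; first by rewrite yA orbT.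
have [->|_] := eqVneq x z; first by rewrite zA orbT.
by rewrite !orbF; case: eqP => //= ->; rewrite inE bB.
Qed.

(** Removing [p] edges with two vertices in [A] turns the sizes [m + p], [2m - p] into [m - p],
    [2m - 2p]; removing [q] edges inside [B] turns [m - q], [2m + q] into [m - q], [2m - 2q]. *)
Let balance :
  exists X, [/\ matchable E X, 1000 * #|X| <= 3 * m & #|B :\: X| = 2 * #|A :\: X|].
Proof.
have cX X : #|B :\: X| + #|X| = #|B| + #|X :&: A| /\
    #|A :\: X| + #|X :&: A| = #|A|.
  have := cardsID X B; have := cardsID X A; have := cardsID A X.
  by rewrite (setIC X A) (setDE X A) setCK (setIC X B); lia.
have [] := leqP #|B| (2 * m) => leB.
  have [|X [mX c3 cA]] := @edges_AAB (#|A| - m); first by have := card_AB; lia.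
  exists X; split=> //; have [cX1 cX2] := cX X.
    by have := card_AB0; have := card_B; have := card_AB; lia.
  by have := card_AB; lia.
have [|X [mX c3 cA]] := @edges_in_B (#|B| - 2 * m).-1; first by lia.
exists X; split=> //; have [cX1 cX2] := cX X.
  by have := card_BA0; have := card_B; have := card_AB; lia.
by have := card_AB; lia.
Qed.

(** * Assembling the perfect matching *)

Lemma matchable_extremal : matchable E setT.
Proof.
have [X1 [mX1 cX1 bal]] := balance.
pose Z := Z0 :\: X1.
have ZZ0 : Z \subset Z0 := subsetDl _ _.
have Z0A : Z0 \subset A by apply/subsetP => x; rewrite !inE => /andP [].
have cZ := subset_leq_card ZZ0.
have ZA : Z \subset A := subset_trans ZZ0 Z0A.
have [|||X2 [mX2 ZX2 X2ZB d21 cX2]] := @greedy_cover _ _ E3 Z B X1.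
- by rewrite disjoints_subset.
- by rewrite disjoints_subset subsetDr.
- move=> z S zZ cS.
  suff /cnt_gt0 [y [w [yB wB zyw]]] : 0 < cnt (adj z) (B :\: S) (B :\: S).
    by exists y, w.
  (* As [z] is not in [B], it forms edges with more than [m * m / 10] pairs of [B0]; discarding
     those that touch [C] costs at most [m * m / 20]. *)
  have cz : m * m < 10 * c z.
    by have := subsetP ZA _ zZ; rewrite !inE -ltnNge.
  pose C := S :|: (B0 :&: A).
  have B0C : B0 \subset (B :\: S) :|: C.
    apply/subsetP => x xB0; rewrite /C /A !in_setU !in_setD !in_setI in_setC xB0.
    by case: (x \in S); case: (x \in B).
  have := cnt_cover (adj z) B0C B0C; rewrite -/(c z) cB0.
  have cC : 80 * #|C| <= m.
    have := leq_card_setU S (B0 :&: A) => /leqifP; rewrite -/C.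
    have := card_AB0; have := card_Z0.
    by case: ifP => _; lia.
  have := leq_mul cC (leqnn m); lia.
pose A' := A :\: (X1 :|: X2); pose B' := B :\: (X1 :|: X2).
(* Each covering edge uses one vertex of [A] and two of [B], so the ratio 1 : 2 survives. *)
have X2A : A :&: X2 = Z.
  apply/setP => x; rewrite in_setI; apply/andP/idP => [[xA xX]|xZ].
    have := subsetP X2ZB _ xX; rewrite in_setU.
    by move: xA; rewrite in_setC => /negPf ->; rewrite orbF.
  by rewrite (subsetP ZA _ xZ) (subsetP ZX2 _ xZ).
have cA' : #|A'| + #|Z| = #|A :\: X1|.
  have := cardsID X2 (A :\: X1); rewrite setDDl -/A' setIDAC X2A.
  suff -> : Z :\: X1 = Z by lia.
  by rewrite /Z setDDl setUid.
have cB' : #|B'| + 2 * #|Z| = #|B :\: X1|.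
  have := cardsID X2 (B :\: X1); rewrite setDDl -/B' setIDAC.
  have -> : B :&: X2 :\: X1 = X2 :\: A.
    apply/setP => x; rewrite !in_setD in_setI in_setC negbK.
    have [xX2|] := boolP (x \in X2); last by rewrite !andbF.
    by rewrite (disjointFr d21 xX2) !andbT.
  by have := cardsID A X2; rewrite (setIC X2) X2A cX2; lia.
have cAm : 100 * m <= 101 * #|A'|.
  have := card_Z0; have := card_BA0; have := card_B; have := card_AB.
  have := cardsID X1 A; have := subset_leq_card (subsetIr A X1); lia.
have dense : matchable E (A' :|: B').
  (* Both [nadj_BB] and [nadj_A] allow [m * m / 8] failures, and 3/8 is well below the square of
     100/101 supplied by [cAm]. *)
  apply: (@matchable_dense _ _ A' B' (m * m %/ 8)).
  - by lia.
  - rewrite disjoints_subset; apply/subsetP => x /setDP [xA _].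
    by move: xA; rewrite !in_setC in_setD negb_and => ->; rewrite orbT.
  - move=> a /setDP [aA aX].
    have /nadj_BB : a \in A :\: Z0.
      rewrite in_setD aA andbT; apply: contra aX => aZ; rewrite in_setU.
      case: (boolP (a \in X1)) => //= aX1; apply: (subsetP ZX2).
      by rewrite in_setD aX1.
    move=> na; rewrite leq_divRL // mulnC; apply: leq_trans na.
    by rewrite leq_mul2l; apply: cnt_sub (subsetDl _ _) (subsetDl _ _).
  - move=> b /setDP [/nadj_A nb _].
    rewrite leq_divRL // mulnC; apply: leq_trans nb.
    by rewrite leq_mul2l; apply: cnt_sub (subsetDl _ _) (subsetT _).
  - have := leq_mul cAm cAm; have := mm_large.
    have : 100 * 100 * #|A'| <= #|A'| * #|A'|.
      by rewrite leq_mul2r; apply/orP; right; lia.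
    have : m * m %/ 8 * 8 <= m * m by apply: leq_trunc_div.
    lia.
have -> : [set: T] = (X2 :|: X1) :|: (A' :|: B').
  apply/setP => x; rewrite /A' /B' /A !in_setU !in_setD !in_setC !in_setU in_setT.
  by case: (x \in X1); case: (x \in X2); case: (x \in B).
apply: matchableU (matchableU mX2 mX1 d21) dense _.
rewrite disjoints_subset /A' /B' -setDUl setCD (setUC X2).
exact: subsetUr.
Qed.

End Extremal.

(** * From degrees and edge density to ordered counts *)

Section EdgeCounts.
Variables (T : finType) (E : {set {set T}}).
Hypothesis E3 : forall e, e \in E -> #|e| = 3.

(** An edge on [v], [y], [z] arises from both [(y, z)] and [(z, y)]. *)
Lemma double_degree_le_cnt v :
  2 * #|[set e in E | v \in e]| <= cnt (adj E v) setT setT.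
Proof.
set F := [set e in E | v \in e].
apply: (@leq_trans
  (\sum_(y in [set: T]) \sum_(z in [set: T]) \sum_(e in F) (e == [set v; y; z]))); last first.
  apply: leq_sum => y _; apply: leq_sum => z _; have [vyz|nvyz] := boolP (adj E v y z).
    rewrite (bigD1 [set v; y; z]) /=; last by rewrite !inE eqxx [_ \in E]vyz.
    rewrite eqxx big1 // => e /andP [_ /negPf -> //].
  rewrite big1 // => e; rewrite inE => /andP [eE _].
  by case: eqP nvyz => // e_eq; rewrite /adj -e_eq eE.
under eq_bigr do rewrite exchange_big /=.
rewrite exchange_big /= mulnC; apply: card_mul_le_sum => e.
rewrite inE => /andP [eE ve].
have /cards2P [y [z [nyz eyz]]] : #|e :\ v| == 2.
  by rewrite -(eqn_add2l (v \in e)) -cardsD1 E3 // ve.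
have e_eq : e = [set v; y; z] by rewrite -setUA -eyz setD1K.
have ge1 a b : e = [set v; a; b] ->
    0 < \sum_(w in [set: T]) (e == [set v; a; w]).
  by move=> {1}->; rewrite (bigD1 b) ?inE //= eqxx.
rewrite (bigD1 y) ?inE //= addnC (bigD1 z) ?inE 1?eq_sym //=.
by have := ge1 z y; rewrite setUAC => /(_ e_eq); have := ge1 y z e_eq; lia.
Qed.

(** All 27 triples over an edge are allowed instead of its 6 orderings; the tiny [alpha0] pays for
    the crude constant. *)
Lemma ordered_triples_le (B : {set T}) :
  \sum_(x in B) cnt (adj E x) B B <= 27 * #|[set e in E | e \subset B]|.
Proof.
set F := [set e in E | e \subset B].
rewrite /cnt; under eq_bigr do rewrite pair_big /=.
rewrite pair_big /=.
rewrite (eq_bigr (fun p => if adj E p.1 p.2.1 p.2.2 then 1 else 0)); last first.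
  by move=> p _; case: (adj E _ _ _).
rewrite -big_mkcondr /= mulnC.
rewrite (partition_big (fun p => [set p.1; p.2.1; p.2.2]) (mem F)) /=; last first.
  move=> [x [y z]] /= /andP [/and3P [xB yB zB] xyz].
  by rewrite inE [_ \in E]xyz !subUset !sub1set xB yB zB.
apply: sum_le_card_mul => e; rewrite inE => /andP [eE _].
rewrite sum1_card.
have <- : #|setX e (setX e e)| = 27 by rewrite !cardsX E3.
apply: subset_leq_card; apply/subsetP => -[x [y z]].
by rewrite unfold_in /= => /andP [_ /eqP <-]; rewrite !inE !eqxx !orbT.
Qed.

End EdgeCounts.

Lemma ex_subset_card (T : finType) (X : {set T}) k :
  k <= #|X| -> exists2 Y : {set T}, Y \subset X & #|Y| = k.
Proof.
move=> kX; exists [set x in take k (enum X)].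
  by apply/subsetP => x; rewrite inE => /mem_take; rewrite mem_enum.
rewrite cardsE (card_uniqP _) ?take_uniq ?enum_uniq // size_take -cardE.
by case: ltnP => //; lia.
Qed.

(** Shrinking only loses triples. Otherwise at most [d] vertices are added, and each new triple has
    an added vertex in one of three positions. *)
Lemma resize_sparse_set (T : finType) (E : {set {set T}}) (B1 : {set T}) k d :
    k <= #|T| -> k <= #|B1| + d ->
  exists2 B0 : {set T}, #|B0| = k &
    \sum_(x in B0) cnt (adj E x) B0 B0 <=
    \sum_(x in B1) cnt (adj E x) B1 B1 + 3 * (d * (k * k)).
Proof.
move=> kT kd; have [kB|Bk] := leqP k #|B1|.
  have [B0 sB cB] := ex_subset_card kB; exists B0 => //.
  apply: leq_trans (leq_addr _ _); rewrite [leqRHS](big_setID B0) /=.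
  rewrite (setIidPr sB); apply: leq_trans (leq_addr _ _).
  by apply: leq_sum => x _; apply: cnt_sub.
have [|C sC cC] := @ex_subset_card T (~: B1) (k - #|B1|).
  by have := cardsC B1; lia.
have dC : B1 :&: C = set0.
  by apply/eqP; rewrite setI_eq0 disjoint_sym disjoints_subset.
have cBC : #|B1 :|: C| = k by rewrite cardsU dC cards0 cC; lia.
exists (B1 :|: C) => //.
have Cd : #|C| <= d by lia.
rewrite (big_setID B1) /= setUK.
have -> : (B1 :|: C) :\: B1 = C.
  rewrite setDUl setDv set0U; apply/setDidPl.
  by rewrite -setI_eq0 setIC dC.
have in_C : \sum_(x in C) cnt (adj E x) (B1 :|: C) (B1 :|: C) <= d * (k * k).
  apply: (@leq_trans (#|C| * (k * k))); last by rewrite leq_mul2r Cd orbT.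
  by apply: sum_le_card_mul => x _; rewrite -{1 2}cBC cnt_max.
have in_B1 : \sum_(x in B1) cnt (adj E x) (B1 :|: C) (B1 :|: C) <=
    \sum_(x in B1) (cnt (adj E x) B1 B1 + 2 * (d * k)).
  apply: leq_sum => x _.
  have := cnt_cover (adj E x) (subxx (B1 :|: C)) (subxx (B1 :|: C)).
  rewrite cBC; have := leq_mul Cd (leqnn k); lia.
move: in_B1; rewrite big_split /= sum_nat_const.
have := leq_mul (ltnW Bk) (leqnn (2 * (d * k))); lia.
Qed.

(** A set with fewer than three elements has density 0 by the convention on division by zero, which
    says nothing; hence the guard on the binomial. *)
Lemma extremal_nat (R : realType) (alpha : R) n (E : {set {set 'I_n}}) K :
    0 < K -> (alpha < K%:R^-1)%R -> extremal alpha E ->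
  exists B : {set 'I_n}, 2 * (K * n) <= 3 * (K * #|B|) + 3 * n /\
    (0 < 'C(#|B|, 3) -> K * #|[set e in E | e \subset B]| <= 'C(#|B|, 3)).
Proof.
move=> K0 aK [B [largeB sparseB]]; exists B.
have KR0 : (0 < K%:R :> R)%R by rewrite ltr0n.
split.
  have /(ler_wpM2l (ltW KR0)) : ((2%:R / 3%:R - K%:R^-1) * n%:R <= #|B|%:R :> R)%R.
    apply: le_trans largeB; rewrite ler_wpM2r ?ler0n // lerD2l lerN2; exact: ltW.
  rewrite mulrA mulrBr divff ?gt_eqF // => le1.
  have : (3%:R * ((K%:R * (2%:R / 3%:R) - 1) * n%:R) <= 3%:R * (K%:R * #|B|%:R) :> R)%R.
    by rewrite ler_pM2l ?ltr0n.
  have -> : (3%:R * ((K%:R * (2%:R / 3%:R) - 1) * n%:R) =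
      2%:R * (K%:R * n%:R) - 3%:R * n%:R :> R)%R.
    by field.
  by rewrite lerBlDr -!natrM -natrD ler_nat.
move=> C0; have CR0 : (0 < 'C(#|B|, 3)%:R :> R)%R by rewrite ltr0n.
move: sparseB; rewrite /density3 ltr_pdivrMr // => lt1.
have : (#|[set e in E | e \subset B]|%:R <= K%:R^-1 * 'C(#|B|, 3)%:R :> R)%R.
  by apply: ltW; apply: lt_trans lt1 _; rewrite ltr_pM2r.
by rewrite mulrC ler_pdivlMr // mulrC -natrM ler_nat.
Qed.

Lemma double_bin2 k : 2 * 'C(k.+1, 2) = k.+1 * k.
Proof. by rewrite mulnC -[2]/(2`!) bin_ffact !ffactnS ffactn0 muln1. Qed.

Lemma bin3_le_cube k : 'C(k, 3) <= k * (k * k).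
Proof.
apply: (@leq_trans ('C(k, 3) * 3`!)); first by rewrite leq_pmulr ?fact_gt0.
rewrite bin_ffact !ffactnS ffactn0 muln1 !leq_mul //; lia.
Qed.

(** * Choice of constants and conclusion *)

Theorem theorem3 (R : realType) :
  exists alpha0 : R, (0 < alpha0)%R /\
  forall alpha : R, (0 < alpha)%R -> (alpha < alpha0)%R ->
  exists n0 : nat,
  forall (n : nat) (E : {set {set 'I_n}}),
    n0 <= n -> 3 %| n ->
    uniform3 E ->
    extremal alpha E ->
    min_deg_ge E ('C(n - 1, 2) - 'C(2 * n %/ 3, 2) + 1) ->
    exists M : {set {set 'I_n}}, perfect_matching E M.
Proof.
(* With this [K], the density loss [27 * 27 / K] plus the cost of resizing stays below the sparsity
   1/10000 that [matchable_extremal] needs. *)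
have [K K_eq] : exists K, K = 100 * 100 * 100 * 100 by exists (100 * 100 * 100 * 100).
have K0 : 0 < K by lia.
exists (K%:R^-1)%R; split; first by rewrite invr_gt0 ltr0n.
move=> alpha _ aK; exists (3 * (100 * 100 * 100)) => n E.
move=> n_large /dvdnP [m n_eq] E3 ext deg.
have m_large : 100 * 100 * 100 <= m by lia.
have cT : #|'I_n| = 3 * m by rewrite card_ord n_eq mulnC.
have [B1 [largeB1 sparseB1]] := extremal_nat K0 aK ext.
have cB1 : #|B1| <= 3 * m by rewrite -cT max_card.
have B1_gt : m <= #|B1| by subst n K; lia.
have few : K * #|[set e in E | e \subset B1]| <= 27 * (m * (m * m)).
  apply: leq_trans (sparseB1 _) _; first by rewrite bin_gt0; lia.
  apply: leq_trans (bin3_le_cube _) _.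
  have := leq_mul cB1 (leq_mul cB1 cB1); lia.
have [d d_eq] : exists d, d = 2 * m - #|B1| by exists (2 * m - #|B1|).
(* The size bound gives [d <= 3 * m / K], and [K / 3] exceeds 33 million. *)
have dm : 100 * 100 * 100 * 33 * d <= m by subst n K; lia.
have [|| B0 cB0 sB0] := @resize_sparse_set _ E B1 (2 * m) d.
- by rewrite cT; lia.
- by lia.
have [M [ME tM cM]] : matchable E setT.
  apply: (@matchable_extremal _ _ m B0) => // [v|].
    have := double_degree_le_cnt E3 v; have := deg v; rewrite /deg1.
    (* Writing [m = j + 1] turns both upper indices into successors, as [double_bin2] requires. *)
    have [j m_j] : exists j, m = j.+1 by exists m.-1; lia.
    have -> : 2 * n %/ 3 = (2 * j + 1).+1 by rewrite n_eq mulnA mulnK; lia.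
    have -> : n - 1 = (3 * j + 1).+1 by lia.
    have := double_bin2 (2 * j + 1); have := double_bin2 (3 * j + 1).
    rewrite m_j; move: 'C(_, 2) 'C(_, 2) #|_| (cnt _ _ _) => c1 c2 d' x.
    by clear; lia.
  rewrite K_eq in few; move: sB0 few (ordered_triples_le E3 B1).
  have := leq_mul dm (leqnn (m * m)).
  move: (\sum_(x in B0) _) (\sum_(x in B1) _) #|_| => e0 e1 e2.
  by clear; lia.
by exists M.
Qed.
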